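(* Let $q\ge 1$ be an integer. For $p=(p_1,\dots,p_q)\in[0,1]^q$ let $$H(p)=-\sum_{b\in\{0,1\}^q} P_p(\Theta_0=\theta_0^b)\,\log\big(P_p(\Theta_0=\theta_0^b)\big),\qquad P_p(\Theta_0=\theta_0^b)=\prod_{c=1}^q p_c^{b_c}(1-p_c)^{1-b_c},$$ be the entropy function associated with $\Theta_0$. Then $H$ has a maximum at the probability vector $p^*=(1/2,\dots,1/2)$; that is, $H(p)\le H(p^* )$ for all $p\in[0,1]^q$.
   Context: There are $q$ candidate variables $z_1,\dots,z_q$ (inputs or outputs) for a data envelopment analysis (DEA) efficiency model. Variable $z_c$ is included in the model with probability $p_c\in[0,1]$, independently over $c$, so the model specification is a random vector $B=(B_1,\dots,B_q)$ of independent Bernoulli variables $B_c\sim Be(p_c)$. For $b\in\{0,1\}^q$, $\theta_0^b$ denotes the efficiency score of a fixed decision making unit $DMU_0$ under specification $b$, and $\Theta_0$ is the random score taking the value $\theta_0^b$ when $B=b$. The notation $P_p(\Theta_0=\theta_0^b)$ always stands for the probability of scenario $b$, i.e. $P_p(\Theta_0=\theta_0^b):=P_p(B=b)=\prod_{c=1}^q p_c^{b_c}(1-p_c)^{1-b_c}$ (different scenarios are counted separately, even if their scores happen to coincide). Conventions: $0^0=1$ and $0\log 0=0$. *)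

(* Defs.v *)
From mathcomp Require Import all_boot all_order all_algebra.
From mathcomp Require Import reals exp.

Set Implicit Arguments.
Unset Strict Implicit.
Unset Printing Implicit Defensive.

Import Order.TTheory GRing.Theory Num.Theory.

Local Open Scope ring_scope.

(* A specification b in {0,1}^q; b c = true means that variable c is included. *)
Definition scenario (q : nat) : finType := {ffun 'I_q -> bool}.

Definition unit_cube (R : realType) (q : nat) (p : 'I_q -> R) : Prop :=
  forall c, 0 <= p c <= 1.

(* P_p(Theta_0 = theta_0^b), that is P_p(B = b) for independent B_c ~ Be(p_c).
   The exponents are 0 or 1, and x ^+ 0 = 1 also for x = 0. *)
Definition scenario_prob (R : realType) (q : nat) (p : 'I_q -> R)
    (b : scenario q) : R :=
  \prod_(c < q) (p c ^+ (b c : nat) * (1 - p c) ^+ (1 - b c)%N).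

(* Natural logarithm. The convention 0 * log 0 = 0 holds because ln is total. *)
Definition entropy (R : realType) (q : nat) (p : 'I_q -> R) : R :=
  - \sum_(b : scenario q) scenario_prob p b * ln (scenario_prob p b).

Definition p_star (R : realType) (q : nat) : 'I_q -> R := fun=> 1 / 2.

Arguments p_star : clear implicits.

(* Main.v *)
Require Import Defs.
From mathcomp Require Import all_boot all_order all_algebra.
From mathcomp Require Import reals exp.

(** By Gibbs' inequality, the entropy of a distribution [P] is at most its
    cross-entropy [- \sum_i P i * ln (Q i)] relative to any other positive
    distribution [Q].  At the centre of the cube every scenario has the same
    probability [2^-q], so with [Q] the distribution of [p_star] the logarithm
    is a constant: the cross-entropy is [- ln (2^-q)] whatever [P] is, and in
    particular it is the entropy of [p_star] when [P = Q].  The upper bound is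
    therefore the value at [p_star].

    Gibbs' inequality ([cross_entropy_ge]) is the sum of the tangent-line bound
    [ln u <= u - 1] at [u = Q i / P i], weighted by [P i]; the error terms
    cancel because [P] and [Q] have the same total mass.  For the scenario
    probabilities that mass is one, which is the expansion of
    [\prod_c (p c + (1 - p c))] ([sum_scenario_prob]). *)

Set Implicit Arguments.
Unset Strict Implicit.
Unset Printing Implicit Defensive.

Import Order.TTheory GRing.Theory Num.Theory.

Local Open Scope ring_scope.

(** Multiplying the tangent-line bound for [ln (y / x)] by [x] makes it linear
    in [x] and [y], and meaningful at [x = 0], where it reads [0 <= y]. *)
Lemma mul_ln_tangent (R : realType) (x y : R) :
  0 <= x -> 0 < y -> x * ln y - x * ln x <= y - x.
Proof.
rewrite le_eqVlt => /orP[/eqP<- y0|x0 y0].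
  by rewrite !mul0r !subr0 ltW.
rewrite -mulrBr -ln_div ?posrE//.
have tangent : ln (y / x) <= y / x - 1.
  by rewrite -[in ln _](subrKC 1 (y / x)) le_ln1Dx// ltrBrDr addNr divr_gt0.
apply: le_trans (ler_wpM2l (ltW x0) tangent) _.
by rewrite mulrBr mulr1 mulrC divfK// gt_eqF.
Qed.

(** Gibbs' inequality: the linear error terms [Q i - P i] of the pointwise
    bounds cancel in the sum, because the two masses agree. *)
Lemma cross_entropy_ge (R : realType) (T : finType) (P Q : T -> R) :
  (forall i, 0 <= P i) -> (forall i, 0 < Q i) ->
  \sum_i P i = \sum_i Q i ->
  - \sum_i P i * ln (P i) <= - \sum_i P i * ln (Q i).
Proof.
move=> P0 Q0 PQ; rewrite lerN2 -subr_le0 -sumrB.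
have mass0 : \sum_i (Q i - P i) = 0 by rewrite sumrB PQ subrr.
rewrite -[leRHS]mass0.
by apply: ler_sum => i _; exact: mul_ln_tangent.
Qed.

Lemma scenario_prob_ge0 (R : realType) (q : nat) (p : 'I_q -> R)
    (b : scenario q) :
  unit_cube p -> 0 <= scenario_prob p b.
Proof.
move=> hp; apply: prodr_ge0 => c _; have /andP[p0 p1] := hp c.
by rewrite mulr_ge0 ?exprn_ge0 ?subr_ge0.
Qed.

(** Distributing [\prod_c (p c + (1 - p c)) = 1] gives one term for each
    choice of a summand in every factor, that is, for each scenario. *)
Lemma sum_scenario_prob (R : realType) (q : nat) (p : 'I_q -> R) :
  \sum_(b : scenario q) scenario_prob p b = 1.
Proof.
rewrite -(bigA_distr_bigA (fun c (j : bool) =>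
  p c ^+ (j : nat) * (1 - p c) ^+ (1 - j)%N)) /=.
apply: big1 => c _.
by rewrite big_bool /= !expr1 !expr0 mulr1 mul1r subrKC.
Qed.

Lemma scenario_prob_star (R : realType) (q : nat) (b : scenario q) :
  scenario_prob (p_star R q) b = 2^-1 ^+ q.
Proof.
have half : 1 - 2^-1 = 2^-1 :> R by rewrite [X in X - _](splitr 1) mul1r addrK.
rewrite -[in RHS](card_ord q) -prodr_const; apply: eq_bigr => c _.
by rewrite /p_star mul1r half -exprD; case: (b c).
Qed.

Lemma unit_cube_star (R : realType) (q : nat) : unit_cube (p_star R q).
Proof. by move=> c; rewrite /p_star mul1r invr_ge0 ler0n invf_le1 ?ler1n. Qed.

Theorem proposition4p1 (R : realType) (q : nat) (hq : (1 <= q)%N) :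
  unit_cube (p_star R q) /\
  forall p : 'I_q -> R, unit_cube p -> entropy p <= entropy (p_star R q).
Proof.
split=> [|p hp]; first exact: unit_cube_star.
have cross (p' : 'I_q -> R) :
    \sum_b scenario_prob p' b * ln (scenario_prob (p_star R q) b)
    = ln (2^-1 ^+ q).
  under eq_bigr => b _ do rewrite scenario_prob_star.
  by rewrite -mulr_suml sum_scenario_prob mul1r.
rewrite [leRHS]/entropy cross -(cross p).
apply: cross_entropy_ge => [b|b|]; first exact: scenario_prob_ge0.
  by rewrite scenario_prob_star exprn_gt0// invr_gt0 ltr0n.
by rewrite !sum_scenario_prob.
Qed.
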